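(* Let $\Omega$ be a centrally symmetric regular cell subdivision of the $n$-dimensional sphere $S^n$, and assume that identifying antipodal points yields a regular subdivision $\Omega'$ of the $n$-dimensional real projective space $P^n$. Write the $\mathbf{c}\mathbf{d}$-index of $\Omega$ as $\Psi(\Omega)=\mathbf{c}^{n+1}+\Phi$. Then $$\Psi(\Omega')=\frac{\mathbf{c}^{n+1}+(\mathbf{a}-\mathbf{b})^{n+1}}{2}+\frac{\Phi}{2}.$$
   Context: For a regular cell complex, $\Psi$ denotes the $\mathbf{a}\mathbf{b}$-index of its face poset (cells together with an adjoined minimum $\hat0$ and maximum $\hat1$, ordered by $\tau<\sigma$ iff $\tau\subseteq\overline\sigma$). For a graded poset of rank $r+1$ and $S\subseteq\{1,\dots,r\}$, $f_S$ counts chains $\hat0<x_1<\cdots<\hat1$ whose set of ranks is exactly $S$, $h_S=\sum_{T\subseteq S}(-1)^{|S-T|}f_T$, and $\Psi=\sum_Sh_Su_S\in\mathbb{Z}\langle\mathbf{a},\mathbf{b}\rangle$ with $u_S=u_1\cdots u_r$, $u_i=\mathbf{b}$ if $i\in S$ else $\mathbf{a}$. For a regular subdivision of a sphere, $\Psi$ is a polynomial in $\mathbf{c}=\mathbf{a}+\mathbf{b}$ and $\mathbf{d}=\mathbf{a}\mathbf{b}+\mathbf{b}\mathbf{a}$ (its $\mathbf{c}\mathbf{d}$-index), whose $\mathbf{c}^{n+1}$ coefficient is $1$. *)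

(* Defs.v *)
From HB Require Import structures.
From mathcomp Require Import all_boot all_order all_algebra.
From mathcomp Require Import finmap.
From mathcomp Require Import boolp classical_sets reals.
From mathcomp Require Import topology normedtype.
(* The notations of monalg clash with those of the analysis library. *)
From mathcomp Require Import -(notations) monalg.

Set Implicit Arguments.
Unset Strict Implicit.
Unset Printing Implicit Defensive.

Import Order.TTheory GRing.Theory Num.Theory.
Import numFieldNormedType.Exports.

Local Open Scope ring_scope.

(* Words in the letters a (encoded by [false]) and b (encoded by [true]). *)
Definition ab_word : Type := seq bool.

HB.instance Definition _ := Choice.on ab_word.

Lemma ab_word_unit (u v : ab_word) : u ++ v = [::] -> u = [::] /\ v = [::].
Proof. by case: u => [|x u] //=; case: v. Qed.

HB.instance Definition _ := Choice_isMonomialDef.Build ab_word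
  (@catA bool) (@cat0s bool) (@cats0 bool) ab_word_unit.

(* Q<a,b>, as the monoid algebra of the free monoid; the coefficients are
   rational rather than integral because the main identity divides by 2. *)
Notation ab_poly := (malg ab_word rat).

Definition var_a : ab_poly := mkmalgU ([:: false] : ab_word) 1.
Definition var_b : ab_poly := mkmalgU ([:: true] : ab_word) 1.
Definition var_c : ab_poly := var_a + var_b.

Section ABIndex.
Context {d : Order.disp_t} {P : finTBPOrderType d}.

Definition is_chain (C : {set P}) : bool :=
  [forall x in C, forall y in C, (x >=< y)%O].

(* In a graded poset all maximal chains of the interval from \bot to x have the
   same length, which is the maximum below. *)
Definition rank (x : P) : nat :=
  \max_(C : {set P} | is_chain C && [forall y in C, (y < x)%O]) #|C|.

(* The poset is meant to be graded of rank r + 1; the ordinal i : 'I_r stands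
   for the rank i + 1, so that {set 'I_r} encodes the subsets of {1, ..., r}. *)
Definition flag_f (r : nat) (S : {set 'I_r}) : nat :=
  #|[set C : {set P} | [&& is_chain C,
       [forall x in C, (\bot < x < \top)%O]
     & [fset rank x | x in C]%fset == [fset (val i).+1 | i in S]%fset]]|.

Definition flag_h (r : nat) (S : {set 'I_r}) : int :=
  \sum_(T : {set 'I_r} | T \subset S) (-1) ^+ #|S :\: T| * (flag_f T)%:Z.

Definition ab_monomial (r : nat) (S : {set 'I_r}) : ab_poly :=
  \prod_(i < r) (if i \in S then var_b else var_a).

Definition ab_index (r : nat) : ab_poly :=
  \sum_(S : {set 'I_r}) (flag_h S)%:~R *: ab_monomial S.

End ABIndex.

Arguments ab_index {d} P r.

Local Open Scope classical_set_scope.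

Section Cells.
Variable R : realType.

Definition sqnorm (m : nat) (x : 'rV[R]_m) : R := \sum_i x ord0 i ^+ 2.

Definition unit_cball (m : nat) : set 'rV[R]_m := [set x | sqnorm x <= 1].
Definition unit_oball (m : nat) : set 'rV[R]_m := [set x | sqnorm x < 1].
Arguments unit_cball : clear implicits.
Arguments unit_oball : clear implicits.

Context {X : topologicalType}.

(* f is a homeomorphism, with inverse g, from the closed unit m-ball onto the
   closure of e; it carries the open unit ball onto e. *)
Definition is_regular_cell (m : nat) (e : set X) : Prop :=
  exists (f : 'rV[R]_m -> X) (g : X -> 'rV[R]_m),
    [/\ {within unit_cball m, continuous f},
        {within closure e, continuous g},
        {in unit_cball m, cancel f g},
        f @` unit_cball m = closure e
      & f @` unit_oball m = e].

(* The members of C are the open cells. *)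
Definition is_regular_subdivision (C : {fset (set X)}) : Prop :=
  [/\ hausdorff_space X,
      \bigcup_(e in [set` C]) e = [set: X],
      (forall e e', e \in C -> e' \in C -> e `&` e' !=set0 -> e = e'),
      (forall e, e \in C -> exists m, is_regular_cell m e)
    & (forall e, e \in C -> exists2 D : set (set X),
         D `<=` [set` C] & closure e `\` e = \bigcup_(e' in D) e')].

End Cells.

Arguments unit_cball {R} m.
Arguments unit_oball {R} m.

Record regular_subdivision (R : realType) (X : topologicalType) :=
  RegularSubdivision {
    cells :> {fset (set X)};
    cellsP : is_regular_subdivision R cells }.

Lemma sqnorm_continuous (R : realType) (m : nat) : continuous (@sqnorm R m).
Proof.
rewrite /sqnorm; apply: continuous_big => [|i _].
  exact: add_continuous.
move=> x; have cx := @coord_continuous R 1 m ord0 i x.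
exact: (cvgM cx cx).
Qed.

Lemma regular_cell_relatively_open (R : realType) (X : topologicalType)
    (m : nat) (e : set X) (x : X) :
  is_regular_cell R m e -> e x -> \forall y \near x, closure e y -> e y.
Proof.
move=> [f [g [_ cg fgK fcl fop]]] ex.
have ogx : unit_oball m (g x).
  move: ex; rewrite -{1}fop => -[y yo <-].
  by rewrite fgK // inE; exact: ltW.
have clx : closure e x by exact: subset_closure.
have gx : \forall u \near g x, unit_oball m u.
  exact: (@sqnorm_continuous _ _ (g x) _ (lt_nbhsl ogx)).
have /subspace_continuousP/(_ _ clx _ gx) := cg.
rewrite /= !nbhs_simpl/= /within/=; apply: filterS => y ygy cly.
move: (cly); rewrite -{1}fcl => -[z zb zy].
rewrite -fop; exists z => //; rewrite -(fgK z) ?inE// zy; exact: ygy.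
Qed.

Inductive face (R : realType) (X : topologicalType)
    (K : regular_subdivision R X) : Type :=
  | Bot
  | Cell of K
  | Top.

Section FacePoset.
Context {R : realType} {X : topologicalType} {K : regular_subdivision R X}.

Let face_code (x : face K) : option (option K) :=
  match x with Bot => None | Top => Some None | Cell e => Some (Some e) end.
Let face_decode (x : option (option K)) : face K :=
  match x with None => Bot K | Some None => Top K | Some (Some e) => Cell e end.
Let face_codeK : cancel face_code face_decode. Proof. by case. Qed.

HB.instance Definition _ := Finite.copy (face K) (can_type face_codeK).

Definition face_le (x y : face K) : bool :=
  match x, y with
  | Bot, _ | _, Top => true
  | Cell e, Cell e' => `[< val e `<=` closure (val e') >]
  | _, _ => false
  end.

Lemma face_le_refl : reflexive face_le.
Proof. by case=> //= e; apply/asboolP; exact: subset_closure. Qed.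

Lemma face_le_anti : antisymmetric face_le.
Proof.
case=> [|e|] [|e'|] //= /andP[/asboolP ee' /asboolP e'e]; congr Cell.
apply: val_inj; have [_ _ disj ball _] := cellsP K.
have [m em] := ball _ (valP e).
have [f [g [_ _ _ _ fop]]] := em.
have ex : (val e) (f 0).
  rewrite -[X in X _]fop; exists 0 => //.
  by rewrite /unit_oball/= /sqnorm big1 // => i _; rewrite mxE expr0n.
apply: disj; [exact: valP|exact: valP|].
have /ee' /(_ _ (regular_cell_relatively_open em ex)) [y [e'y]] := ex.
by move=> /(_ (e'e _ e'y)) ey; exists y.
Qed.

Lemma face_le_trans : transitive face_le.
Proof.
case=> [|e|] [|e'|] [|e''|] //= /asboolP h1 /asboolP h2; apply/asboolP.
apply: subset_trans h1 _; apply: subset_trans (closureS h2) _.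
by have /closure_id <- := @closed_closure _ (val e'').
Qed.

Fact face_display : Order.disp_t. Proof. exact: Order.Disp tt tt. Qed.

HB.instance Definition _ := Order.Le_isPOrder.Build face_display (face K)
  face_le_refl face_le_anti face_le_trans.

Lemma face_le0x (x : face K) : (Bot K <= x)%O. Proof. by []. Qed.
Lemma face_lex1 (x : face K) : (x <= Top K)%O. Proof. by case: x. Qed.

HB.instance Definition _ :=
  Order.hasBottom.Build face_display (face K) face_le0x.
HB.instance Definition _ :=
  Order.hasTop.Build face_display (face K) face_lex1.

End FacePoset.

(* n is the dimension of X: the face poset then has rank n + 2. *)
Definition Psi (R : realType) (X : topologicalType)
    (K : regular_subdivision R X) (n : nat) : ab_poly :=
  ab_index (face K) n.+1.

Section Antipodes.
Variables (R : realType) (n : nat).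

Definition unit_sphere : set 'rV[R]_n.+1 := [set x | sqnorm x = 1].

Lemma antipode_subproof (x : unit_sphere) : - val x \in unit_sphere.
Proof.
case: x => x /=; rewrite !inE /unit_sphere/= => <-.
by rewrite /sqnorm; apply: eq_bigr => i _; rewrite mxE sqrrN.
Qed.

Definition antipode (x : unit_sphere) : unit_sphere :=
  exist _ (- val x) (antipode_subproof x).

Definition antipodal (x y : unit_sphere) : bool := (y == x) || (y == antipode x).

Lemma antipodeK : involutive antipode.
Proof. by move=> x; apply: val_inj; rewrite /= opprK. Qed.

Lemma antipodal_equiv_class : equiv_class_of antipodal.
Proof.
split=> [x|x y|y x z]; rewrite /antipodal.
- by rewrite eqxx.
- by rewrite eq_sym [y == antipode x]eq_sym (can2_eq antipodeK antipodeK).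
- by case/orP=> /eqP-> /orP[] /eqP->; rewrite ?antipodeK ?eqxx ?orbT.
Qed.

Canonical antipodal_equiv := EquivRelPack antipodal_equiv_class.

Definition sphere : topologicalType := set_type unit_sphere.

Definition proj_space : topologicalType :=
  quotient_topology {eq_quot antipodal_equiv}%qT.

Definition to_proj (x : sphere) : proj_space := (\pi_proj_space x)%qT.

Definition centrally_symmetric (C : {fset (set sphere)}) : Prop :=
  forall e : set sphere, e \in C -> antipode @` e \in C.

Definition antipodal_image (C : {fset (set sphere)}) :
    {fset (set proj_space)} :=
  [fset (to_proj @` e)%classic | e : set sphere in C]%fset.

End Antipodes.

Arguments sphere : clear implicits.
Arguments proj_space : clear implicits.

(* Main.v *)
(* It suffices that a nonempty chain of proper faces of Omega' has exactly two
   lifts to Omega, with the same ranks: then f_S(Omega) = 2 f_S(Omega') for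
   nonempty S while f_S = 1 for S empty in both posets, so that
   2 h_S(Omega') = h_S(Omega) + (-1)^|S|, and the signs add up to (a - b)^(n+1).

   Chains lift in this way because the closure of a cell of Omega contains no
   two antipodal points. Its image in P^n is a closed ball, over which the double
   cover S^n -> P^n has a section: walk from the center along the rays in steps
   so short that successive lines are not orthogonal, projecting the current unit
   vector orthogonally onto the next line and normalizing. The section and its
   antipode split the preimage of the ball into two disjoint closed sets, one of
   which contains the connected closure of the cell. *)
Require Import Defs.
From mathcomp Require Import all_boot all_order all_algebra.
From mathcomp Require Import finmap.
From mathcomp Require Import reals topology.
From mathcomp Require Import -(notations) monalg.

Set Implicit Arguments.
Unset Strict Implicit.
Unset Printing Implicit Defensive.

Import Order.TTheory GRing.Theory Num.Theory.

Local Open Scope ring_scope.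

(** * Flag numbers of two-sheeted coverings of posets *)

Lemma chain_max d (P : finPOrderType d) (C : {set P}) :
  [forall x in C, forall y in C, (x >=< y)%O] -> C != set0 ->
  exists2 q, q \in C & forall x, x \in C -> (x <= q)%O.
Proof.
move=> /forall_inP chC /set0Pn[x0 x0C].
have cmp : {in mem C &, forall x y, (x >=< y)%O}.
  by move=> x y xC yC; have /forall_inP := chC x xC; apply.
by case: (comparable_arg_maxP (F := id) x0C cmp) => q qC qmax; exists q.
Qed.

Section DoubleCover.
Context {dP dQ : Order.disp_t}.
Context {P : finTBPOrderType dP} {Q : finTBPOrderType dQ}.
Variable f : P -> Q.
Hypothesis f_homo : {homo f : x y / (x <= y)%O}.
Hypothesis f_bot : forall x, (f x == \bot%O) = (x == \bot%O).
Hypothesis f_top : forall x, (f x == \top%O) = (x == \top%O).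
(** With [f_homo] and [f_lift], this makes [f] an isomorphism from the elements below [p] onto those
    below [f p]. The top is excluded because both points of a fiber lie below it. *)
Hypothesis f_embed : forall p x y, p != \top%O -> (x <= p)%O -> (y <= p)%O ->
  (f x <= f y)%O -> (x <= y)%O.
Hypothesis f_lift : forall p q, p != \top%O -> (q <= f p)%O ->
  exists2 x, (x <= p)%O & f x = q.
Hypothesis f_fiber : forall q, (\bot < q < \top)%O ->
  exists x y, x <> y /\ forall z, f z = q <-> z = x \/ z = y.

(** For [p] other than the top and [D] below [f p], this is the only lift of [D] among the elements
    below [p]. *)
Definition lift_below (p : P) (D : {set Q}) : {set P} :=
  [set x | (x <= p)%O && (f x \in D)].

Lemma card_fiber q : (\bot < q < \top)%O -> #|[set x | f x == q]| = 2%N.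
Proof.
move=> /f_fiber[x [y [/eqP xy fq]]].
have -> : [set z | f z == q] = [set x; y]; last by rewrite cards2 xy.
apply/setP => z; rewrite !inE.
apply/eqP/orP => [/fq[]->|[]/eqP zE]; [by left|by right| |]; apply/fq;
  by [left|right].
Qed.

Lemma f_inj_below p : p != \top%O -> {in <= p & , injective f}%O.
Proof.
move=> pT x y xp yp fxy; apply/eqP; rewrite eq_le.
by apply/andP; split; apply: (f_embed pT) => //; rewrite fxy.
Qed.

Lemma f_lt p x : p != \top%O -> (x <= p)%O -> (f x < f p)%O = (x < p)%O.
Proof.
move=> pT xp; rewrite !lt_def f_homo // xp !andbT; congr (~~ _).
by apply/eqP/eqP => [/(f_inj_below pT)->|->//]; rewrite // inE.
Qed.

Lemma f_proper x : (\bot < f x < \top)%O = (\bot < x < \top)%O.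
Proof. by rewrite !lt0x !ltx1 f_bot f_top. Qed.

Lemma is_chainP d (T : finTBPOrderType d) (C : {set T}) :
  reflect {in C &, forall x y, (x >=< y)%O} (is_chain C).
Proof.
apply: (iffP forall_inP) => [h x y xC yC|h x xC]; last first.
  by apply/forall_inP => y yC; exact: h.
by have /forall_inP := h x xC; apply.
Qed.

Lemma is_chain_imset (C : {set P}) : is_chain C -> is_chain (f @: C).
Proof.
move=> /is_chainP chC; apply/is_chainP => _ _ /imsetP[x xC ->] /imsetP[y yC ->].
by apply/orP; case/orP: (chC x y xC yC) => /f_homo; [left|right].
Qed.

Lemma is_chain_lift_below p D :
  p != \top%O -> is_chain D -> is_chain (lift_below p D).
Proof.
move=> pT /is_chainP chD; apply/is_chainP => x y.
rewrite !inE => /andP[xp xD] /andP[yp yD].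
apply/orP; case/orP: (chD _ _ xD yD) => fxy; [left|right];
  exact: (f_embed pT) fxy.
Qed.

Lemma imset_lift_below p (D : {set Q}) :
  p != \top%O -> (forall q, q \in D -> (q <= f p)%O) -> f @: lift_below p D = D.
Proof.
move=> pT Dp; apply/setP => q; apply/imsetP/idP => [[x + ->]|qD].
  by rewrite inE => /andP[].
by have [x xp xq] := f_lift pT (Dp q qD); exists x; rewrite // inE xp xq.
Qed.

(** Chains are transported both ways: one strictly below [f p] is the image of its lift, which is
    thus at least as large, and [f] is injective on one strictly below [p]. *)
Lemma rank_cover p : p != \top%O -> rank (f p) = rank p.
Proof.
move=> pT; apply/eqP; rewrite eqn_leq; apply/andP; split.
  apply/bigmax_leqP => D /andP[chD /forall_inP Dp].
  rewrite -(imset_lift_below pT (fun q qD => ltW (Dp q qD))).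
  apply: leq_trans (leq_imset_card _ _) _.
  apply: (@leq_bigmax_cond _ _ (fun C : {set P} => #|C|)).
  rewrite is_chain_lift_below //=; apply/forall_inP => x.
  by rewrite inE => /andP[xp xD]; rewrite -f_lt // Dp.
apply/bigmax_leqP => C /andP[chC /forall_inP Cp].
rewrite -(card_in_imset (f := f)); last first.
  by move=> x y /Cp/ltW xp /Cp/ltW yp; apply: (f_inj_below pT).
apply: (@leq_bigmax_cond _ _ (fun C : {set Q} => #|C|)).
rewrite is_chain_imset //=; apply/forall_inP => _ /imsetP[x xC ->].
by rewrite f_lt ?Cp // ltW // Cp.
Qed.

Lemma rank_imset (C : {set P}) : (forall x, x \in C -> (\bot < x < \top)%O) ->
  [fset rank x | x in f @: C]%fset = [fset rank x | x in C]%fset.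
Proof.
move=> Cp; apply/fsetP => k; apply/imfsetP/imfsetP => /= -[].
  move=> _ /imsetP[x xC ->] ->; exists x => //; rewrite rank_cover //.
  by have /andP[_ /lt_eqF->] := Cp x xC.
move=> x xC ->; exists (f x); first exact: imset_f.
by rewrite rank_cover //; have /andP[_ /lt_eqF->] := Cp x xC.
Qed.

Definition flag_chains d (T : finTBPOrderType d) (r : nat) (S : {set 'I_r}) :
    {set {set T}} :=
  [set C | [&& is_chain C, [forall x in C, (\bot < x < \top)%O]
    & [fset rank x | x in C]%fset == [fset (val i).+1 | i in S]%fset]].
Arguments flag_chains {d} T {r} S.

Lemma flag_chains_imset r (S : {set 'I_r}) (C : {set P}) :
  C \in flag_chains P S -> f @: C \in flag_chains Q S.
Proof.
rewrite !inE => /and3P[chC /forall_inP Cp rC].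
rewrite is_chain_imset //= rank_imset // rC andbT.
by apply/forall_inP => _ /imsetP[x xC ->]; rewrite f_proper Cp.
Qed.

Lemma flag_chains_lift_below r (S : {set 'I_r}) p (D : {set Q}) : p != \top%O ->
  (forall q, q \in D -> (q <= f p)%O) ->
  D \in flag_chains Q S -> lift_below p D \in flag_chains P S.
Proof.
move=> pT Dp; rewrite !inE => /and3P[chD /forall_inP Dpr rD].
have Lpr x : x \in lift_below p D -> (\bot < x < \top)%O.
  by rewrite inE => /andP[_ xD]; rewrite -f_proper Dpr.
rewrite is_chain_lift_below //= -rank_imset // imset_lift_below // rD andbT.
exact/forall_inP.
Qed.

(* A nonempty chain has as many lifts as its maximum. *)
Lemma card_chain_lifts r (S : {set 'I_r}) (D : {set Q}) :
  D \in flag_chains Q S -> D != set0 ->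
  #|[set C in flag_chains P S | f @: C == D]| = 2%N.
Proof.
move=> DS D0; have := DS; rewrite inE => /and3P[chD /forall_inP Dp _].
have [q qD qmax] := chain_max chD D0.
rewrite -(card_fiber (Dp q qD)).
(* [p] is recovered from [lift_below p D] as its greatest element. *)
rewrite -(@card_in_imset _ _ (lift_below^~ D)); last first.
  move=> x y; rewrite !inE => /eqP fx /eqP fy /setP xy.
  have := xy y; have := xy x.
  rewrite !inE fx fy qD !lexx !andbT => /esym xley ylex.
  by apply/eqP; rewrite eq_le xley ylex.
have fibT p : f p = q -> p != \top%O.
  by move=> fp; rewrite -f_top fp; have /andP[_ /lt_eqF->] := Dp q qD.
congr #|pred_of_set _|; apply/setP => C; rewrite inE; apply/andP/imsetP.
  move=> [CS /eqP CD]; have : q \in f @: C by rewrite CD.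
  case/imsetP => p pC qp; exists p; first by rewrite inE qp.
  have pT := fibT p (esym qp).
  (* The lift [p] of the maximum of [D] is the maximum of [C]: if [p] lies below [x], then [f x]
     lies below [f p], and embedding below [x] gives the converse inequality. *)
  have Cp x : x \in C -> (x <= p)%O.
    move=> xC; move: CS; rewrite inE => /and3P[/is_chainP/(_ x p xC pC)].
    case/orP => // px /forall_inP/(_ x xC)/andP[_ xT] _.
    apply: (f_embed (negbT (lt_eqF xT))) => //.
    by rewrite -qp qmax // -CD imset_f.
  apply/setP => x; rewrite inE -CD; apply/idP/andP => [xC|[xp]].
    by rewrite Cp // imset_f.
  by case/imsetP => y yC /(f_inj_below pT)-> //; exact: Cp.
case=> p; rewrite inE => /eqP fp ->.
have Dfp x : x \in D -> (x <= f p)%O by rewrite fp; exact: qmax.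
by rewrite flag_chains_lift_below ?imset_lift_below ?fibT.
Qed.

(** Chains of [P] are sorted by their images, each of which has two lifts. *)
Lemma flag_f_cover r (S : {set 'I_r}) : S != set0 ->
  @flag_f _ P r S = (2 * @flag_f _ Q r S)%N.
Proof.
move=> S0; rewrite -[LHS]/#|flag_chains P S|.
rewrite -[@flag_f _ Q r S]/#|flag_chains Q S| mulnC -sum_nat_const -sum1_card.
rewrite (partition_big (fun C : {set P} => f @: C) (mem (flag_chains Q S))) /=;
  last exact: flag_chains_imset.
apply: eq_bigr => D DS.
rewrite -(card_chain_lifts DS).
  by rewrite -sum1_card; apply: eq_bigl => C; rewrite inE.
(* The empty chain has only one lift, but its set of ranks is empty, unlike [S]. *)
apply: contraNneq S0 => D0.
move: DS; rewrite D0 inE => /and3P[_ _ /eqP/fsetP rS].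
apply/eqP/setP => i; rewrite inE; apply/negP => iS.
have := rS i.+1; rewrite [RHS]in_imfset //= => /imfsetP[x] /=.
by rewrite inE.
Qed.

End DoubleCover.

(** * From flag numbers to the ab-index *)

Lemma flag_f0 d (P : finTBPOrderType d) r : @flag_f _ P r set0 = 1%N.
Proof.
rewrite /flag_f -(cards1 (set0 : {set P})); congr #|pred_of_set _|.
apply/setP => C; rewrite !inE; apply/and3P/eqP => [[_ _ /eqP/fsetP rC]|->].
  apply/setP => x; rewrite inE; apply/negP => xC.
  have := rC (rank x); rewrite in_imfset //= => /esym/imfsetP[i] /=.
  by rewrite inE.
split; [by apply/is_chainP => x y; rewrite inE| |].
  by apply/forall_inP => x; rewrite inE.
by apply/eqP/fsetP => k; apply/imfsetP/imfsetP => -[x] /=; rewrite inE.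
Qed.

(** Doubling turns each term with [T] nonempty into the term for [P]. The empty set contributes
    (-1)^|S| to both sums, so one extra copy of it remains. *)
Lemma flag_h_halve dP dQ (P : finTBPOrderType dP) (Q : finTBPOrderType dQ) r
    (S : {set 'I_r}) :
  (forall T : {set 'I_r}, T != set0 ->
    @flag_f _ P r T = (2 * @flag_f _ Q r T)%N) ->
  2 * @flag_h _ Q r S = @flag_h _ P r S + (-1) ^+ #|S|.
Proof.
move=> PQ; rewrite /flag_h mulr_sumr.
rewrite (bigD1 set0) ?sub0set //= [in RHS](bigD1 set0) ?sub0set //=.
rewrite !flag_f0 setD0 !mulr1 mulrDl mul1r -!addrA; congr (_ + _).
rewrite addrC; congr (_ + _); apply: eq_bigr => T /andP[_ T0].
by rewrite PQ // PoszM mulrCA.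
Qed.

(* The algebra structure of [ab_poly] is only that of a left algebra, hence the
   detour through signs instead of general scalars. *)
Lemma prodr_opp_if (K : pzRingType) (A : lalgType K) (I : Type) (r : seq I)
    (D : pred I) (F : I -> A) :
  \prod_(i <- r) (if D i then - F i else F i) =
  (-1) ^+ count D r *: \prod_(i <- r) F i.
Proof.
elim: r => [|i r IH]; first by rewrite !big_nil scale1r.
rewrite !big_cons IH /= exprD -scalerA -(signr_odd _ (count D r)) !scaler_sign.
by case: (D i); case: odd; rewrite ?mulNr ?mulrN.
Qed.

(** Distributivity: [S] records the factors of the power from which -b is taken. *)
Lemma alternating_ab_monomials r :
  \sum_(S : {set 'I_r}) (-1) ^+ #|S| *: ab_monomial S = (var_a - var_b) ^+ r.
Proof.
have -> : (var_a - var_b) ^+ r = \prod_(i < r) (- var_b + var_a).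
  by rewrite prodr_const card_ord addrC.
rewrite bigA_distr; apply: eq_big => [S|S _]; first by rewrite inE.
rewrite -sum1_card sum1_count -prodr_opp_if; apply: eq_bigr => i _.
by rewrite /=; case: (i \in S).
Qed.

Lemma ab_index_halve dP dQ (P : finTBPOrderType dP) (Q : finTBPOrderType dQ) r :
  (forall T : {set 'I_r}, T != set0 ->
    @flag_f _ P r T = (2 * @flag_f _ Q r T)%N) ->
  ab_index Q r = 2^-1 *: (ab_index P r + (var_a - var_b) ^+ r).
Proof.
move=> PQ; rewrite -alternating_ab_monomials -big_split scaler_sumr.
apply: eq_bigr => S _ /=; rewrite -scalerDl scalerA; congr (_ *: _).
have := congr1 (fun z => z%:~R : rat) (flag_h_halve S PQ).
rewrite /= intrM intrD rmorphXn rmorphN1 /= => <-.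
by rewrite mulKf.
Qed.

(** * Lifting closed balls to the sphere *)

From mathcomp Require Import boolp classical_sets functions normedtype realfun.
From mathcomp Require Import lra.
Import numFieldNormedType.Exports.

Local Open Scope classical_set_scope.

Lemma continuous_matrix (X T : topologicalType) (m n : nat)
    (f : X -> 'M[T]_(m, n)) :
  (forall i j, continuous (fun x => f x i j)) -> continuous f.
Proof.
move=> cf x A [P Pf PA]; rewrite nbhs_simpl /=.
have : \forall y \near x, forall ij : 'I_m * 'I_n, P ij.1 ij.2 (f y ij.1 ij.2).
  by apply: filter_forall => ij; exact: cf (Pf ij.1 ij.2).
by apply: filterS => y Py; apply: PA => i j; exact: (Py (i, j)).
Qed.

Lemma continuous_sum (X : topologicalType) (R : realType) (I : Type)
    (r : seq I) (f : I -> X -> R) :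
  (forall i, continuous (f i)) -> continuous (fun x => \sum_(i <- r) f i x).
Proof.
by move=> cf; apply: continuous_big => //; exact: add_continuous.
Qed.

Lemma continuous_compT (X Y Z : topologicalType) (f : X -> Y) (g : Y -> Z) :
  continuous f -> continuous g -> continuous (fun x => g (f x)).
Proof. by move=> cf cg x; apply: continuous_comp; [exact: cf|exact: cg]. Qed.

Lemma continuous_mul (X : topologicalType) (R : realType) (f g : X -> R) :
  continuous f -> continuous g -> continuous (fun x => f x * g x).
Proof. by move=> cf cg x; apply: continuousM; [exact: cf|exact: cg]. Qed.

(** * Unit vectors and the lines they span *)

Section Sphere.
Variables (R : realType) (n : nat).
Implicit Types x y : sphere R n.

Lemma to_projE x y : to_proj x = to_proj y <-> y = x \/ y = antipode x.
Proof.
have xyP : reflect (to_proj x = to_proj y) (antipodal x y).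
  exact: (@eqmodP _ (antipodal_equiv R n)).
split=> [/xyP/orP[]/eqP|xy]; [by left|by right|].
by apply/xyP/orP; case: xy => ->; [left|right].
Qed.

Lemma to_proj_antipode x : to_proj (antipode x) = to_proj x.
Proof. by apply/esym/to_projE; right. Qed.

Lemma to_proj_repr (p : proj_space R n) : to_proj (repr p) = p.
Proof. exact: reprK. Qed.

Lemma to_proj_continuous : continuous (@to_proj R n).
Proof. exact: pi_continuous. Qed.

Lemma continuous_sphere (X : topologicalType) (f : X -> sphere R n) :
  continuous (fun z => val (f z)) -> continuous f.
Proof. by move=> cf; exact: (@continuous_comp_initial _ _ _ set_val). Qed.

Lemma continuous_sphere_val : continuous (fun x : sphere R n => val x).
Proof. exact: initial_continuous. Qed.

Lemma continuous_sphere_coord j : continuous (fun x => val x ord0 j).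
Proof.
move=> x; apply: (@continuous_comp _ _ _ (fun y : sphere R n => val y)
  (fun M : 'rV[R]_n.+1 => M ord0 j)); first exact: continuous_sphere_val.
exact: coord_continuous.
Qed.

Lemma antipode_continuous : continuous (@antipode R n).
Proof.
apply: continuous_sphere => x; apply: continuousN; exact: continuous_sphere_val.
Qed.

Lemma sqnorm_sphere x : sqnorm (val x) = 1.
Proof. exact: (set_valP x). Qed.

Lemma antipode_neq x : antipode x <> x.
Proof.
move=> /(congr1 val) /= xx; have := sqnorm_sphere x.
suff -> : val x = 0.
  rewrite /sqnorm big1 => [/eqP|i _]; first by rewrite eq_sym oner_eq0.
  by rewrite mxE expr0n.
by apply/rowP=> j; move/rowP: xx => /(_ j); rewrite !mxE; lra.
Qed.

Definition dot x y : R := \sum_i val x ord0 i * val y ord0 i.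

Lemma dotNr x y : dot x (antipode y) = - dot x y.
Proof. by rewrite /dot -sumrN; apply: eq_bigr => i _; rewrite /= mxE mulrN. Qed.

Lemma dotxx x : dot x x = 1.
Proof. by rewrite -(sqnorm_sphere x); apply: eq_bigr => i _; rewrite expr2. Qed.

(* Entries of the orthogonal projection onto the line [p]. *)
Definition line_mx (p : proj_space R n) (i j : 'I_n.+1) : R :=
  val (repr p) ord0 i * val (repr p) ord0 j.

Lemma line_mxE x i j : line_mx (to_proj x) i j = val x ord0 i * val x ord0 j.
Proof.
rewrite /line_mx; have /to_projE := esym (to_proj_repr (to_proj x)).
by case=> -> //=; rewrite !mxE mulrNN.
Qed.

(** The product of two coordinates is continuous on the sphere and equal at antipodes, so it
    descends to the quotient. *)
Lemma line_mx_continuous i j : continuous (fun p => line_mx p i j).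
Proof.
apply: (@repr_comp_continuous _ {eq_quot (antipodal_equiv R n)}%qT _
   (fun x : sphere R n => val x ord0 i * val x ord0 j)).
  by move=> x; apply: continuousM; exact: continuous_sphere_coord.
move=> x y /eqP/to_projE [] -> //=; by rewrite !mxE mulrNN.
Qed.

(** The trace of the product of the two projections, that is, the squared cosine of the angle
    between the lines. It is positive exactly when they are not orthogonal. *)
Definition overlap (p q : proj_space R n) : R :=
  \sum_i \sum_j line_mx p i j * line_mx q i j.

Lemma overlapE x y : overlap (to_proj x) (to_proj y) = dot x y ^+ 2.
Proof.
rewrite /overlap expr2 {1}/dot mulr_suml; apply: eq_bigr => i _.
rewrite /dot mulr_sumr; apply: eq_bigr => j _.
by rewrite !line_mxE mulrACA.
Qed.

Lemma overlap_continuous (X : topologicalType) (f g : X -> proj_space R n) :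
  continuous f -> continuous g -> continuous (fun z => overlap (f z) (g z)).
Proof.
move=> cf cg; apply: continuous_sum => i; apply: continuous_sum => j.
apply: continuous_mul.
  exact: (continuous_compT cf (@line_mx_continuous i j)).
exact: (continuous_compT cg (@line_mx_continuous i j)).
Qed.

(* The lift of [f z] closest to [s z] is the normalized orthogonal projection of
   [s z] onto the line [f z]. *)
Lemma lift_step (X : topologicalType) (s : X -> sphere R n)
    (f : X -> proj_space R n) :
  continuous s -> continuous f ->
  (forall z, 0 < overlap (to_proj (s z)) (f z)) ->
  exists2 s' : X -> sphere R n, continuous s' & forall z, to_proj (s' z) = f z.
Proof.
move=> cs cf ov.
pose w z : sphere R n := repr (f z).
have wf z : to_proj (w z) = f z by exact: to_proj_repr.
pose s' z := if 0 < dot (s z) (w z) then w z else antipode (w z).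
have s'f z : to_proj (s' z) = f z.
  by rewrite /s'; case: ifP; rewrite ?to_proj_antipode.
have ds' z : dot (s z) (s' z) = Num.sqrt (overlap (to_proj (s z)) (f z)).
  rewrite -wf overlapE sqrtr_sqr /s'; case: ltP => [/gtr0_norm-> //|].
  by rewrite dotNr => /ler0_norm ->.
(* This formula involves neither the arbitrary representative [w z] nor the choice of sign, so
   continuity can be read off it. *)
have s'E z j : val (s' z) ord0 j =
    (Num.sqrt (overlap (to_proj (s z)) (f z)))^-1 *
    \sum_i val (s z) ord0 i * line_mx (f z) i j.
  rewrite -(s'f z); under eq_bigr do rewrite line_mxE mulrA.
  rewrite -mulr_suml -/(dot _ _) s'f ds' mulrA mulVf ?mul1r //.
  by rewrite gt_eqF // sqrtr_gt0.
exists s' => //; apply: continuous_sphere; apply: continuous_matrix => i j.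
rewrite (ord1 i); under eq_fun do rewrite s'E.
apply: continuous_mul => [z|].
  have q0 : Num.sqrt (overlap (to_proj (s z)) (f z)) != 0.
    by rewrite gt_eqF // sqrtr_gt0.
  apply: (cvgV q0).
  have cov := overlap_continuous (continuous_compT cs to_proj_continuous) cf.
  exact: (continuous_compT cov (@sqrt_continuous R)).
apply: continuous_sum => {}i; apply: continuous_mul.
  exact: (continuous_compT cs (@continuous_sphere_coord i)).
exact: (continuous_compT cf (@line_mx_continuous i j)).
Qed.

End Sphere.

(** * The closed Euclidean ball *)

Section Ball.
Variables (R : realType) (m : nat).
Implicit Type x : 'rV[R]_m.

Lemma sqnorm_ge0 x : 0 <= sqnorm x.
Proof. by apply: sumr_ge0 => i _; exact: sqr_ge0. Qed.

Lemma sqnormZ (a : R) x : sqnorm (a *: x) = a ^+ 2 * sqnorm x.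
Proof. by rewrite mulr_sumr; apply: eq_bigr => i _; rewrite mxE exprMn. Qed.

Lemma unit_cballZ (a : R) x :
  0 <= a <= 1 -> unit_cball m x -> unit_cball m (a *: x).
Proof.
move=> /andP[a0 a1] x1; rewrite /unit_cball/= sqnormZ.
by rewrite mulr_ile1 ?sqnorm_ge0 ?sqr_ge0 // expr_le1.
Qed.

(** The norm on row vectors is the maximum norm, which the Euclidean norm dominates. *)
Lemma unit_cball_norm x : unit_cball m x -> `|x| <= 1.
Proof.
move=> x1; rewrite [leLHS]/Num.norm /= mx_normrE.
apply/bigmax_leP; split=> // -[i j] _ /=.
rewrite (ord1 i) -(@ler_pXn2r _ 2) ?nnegrE // expr1n real_normK ?num_real //.
apply: le_trans x1; rewrite /sqnorm (bigD1 j) //= lerDl.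
by apply: sumr_ge0 => k _; exact: sqr_ge0.
Qed.

Lemma unit_cball_compact : compact (unit_cball m : set 'rV[R]_m).
Proof.
apply: bounded_closed_compact.
  exists 1; split=> // M M1 x /unit_cball_norm x1; exact: le_trans (ltW M1).
have -> : unit_cball m = @sqnorm R m @^-1` [set t | t <= 1] by [].
apply: closed_comp; last exact: closed_le.
by move=> x _; exact: sqnorm_continuous.
Qed.

(** The ball is a union of segments through the center. *)
Lemma unit_cball_connected : connected (unit_cball m : set 'rV[R]_m).
Proof.
have -> : unit_cball m =
    \bigcup_(x in unit_cball m) ((fun t : R => t *: x) @` `[0, 1]).
  apply/seteqP; split=> [x x1|_ [x x1 [t + <-]]].
    by exists x => //; exists 1; rewrite ?scale1r //= in_itv/= ler01 lexx.
  by rewrite /= in_itv/= => t01; exact: unit_cballZ.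
apply: bigcup_connected => [|x x1].
  exists 0 => x _ /=; exists 0; rewrite ?scale0r //= in_itv/= ler01 lexx //.
apply: connected_continuous_connected; first exact: segment_connected.
apply: continuous_subspaceT => t.
by apply: cvgZr_tmp; exact: cvg_id.
Qed.

(** The radial retraction of the whole space onto the ball. Composing with it replaces continuity
    within the ball by continuity everywhere. *)
Definition ball_retract x : 'rV[R]_m :=
  (Num.max 1 (Num.sqrt (sqnorm x)))^-1 *: x.

Lemma ball_retract_in x : unit_cball m (ball_retract x).
Proof.
rewrite /unit_cball/= sqnormZ exprVn mulrC ler_pdivrMr ?mul1r; last first.
  by rewrite exprn_gt0 // lt_max ltr01.
rewrite -[leLHS]sqr_sqrtr ?sqnorm_ge0 // ler_pXn2r ?nnegrE ?sqrtr_ge0 //.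
  by rewrite le_max lexx orbT.
by rewrite le_max ler01.
Qed.

Lemma ball_retract_id x : unit_cball m x -> ball_retract x = x.
Proof.
move=> x1; rewrite /ball_retract max_l ?invr1 ?scale1r //.
by rewrite -sqrtr1 ler_sqrt.
Qed.

Lemma ball_retract_continuous : continuous ball_retract.
Proof.
move=> x; pose q (y : 'rV[R]_m) : R := Num.max 1 (Num.sqrt (sqnorm y)).
have csq := continuous_compT (@sqnorm_continuous R m) (@sqrt_continuous R).
have cq : q @ x --> q x.
  have c1 : {for x, continuous (cst 1 : 'rV[R]_m -> R)}.
    exact: cst_continuous.
  exact: (continuous_max c1 (csq x)).
have q0 : q x != 0 by rewrite gt_eqF // lt_max ltr01.
exact: (cvgZ (cvgV q0 cq) cvg_id).
Qed.

Lemma continuous_ball_retract (T : topologicalType) (f : 'rV[R]_m -> T) :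
  {within unit_cball m, continuous f} ->
  continuous (fun x => f (ball_retract x)).
Proof.
move=> /subspace_continuousP cf x U /(cf _ (ball_retract_in x)).
rewrite /= nbhs_simpl /within /= => /(@ball_retract_continuous x).
rewrite /= !nbhs_simpl /=.
by apply: filterS => y; apply; exact: ball_retract_in.
Qed.

End Ball.

(** * Lifting maps from the ball to projective space *)

Section Lift.
Variables (R : realType) (n m : nat).

(** A line has overlap 1 with itself, so the overlap stays positive near the diagonal; compactness
    of the ball makes this uniform. *)
Lemma overlap_uniform (F : 'rV[R]_m -> proj_space R n) : continuous F ->
  exists2 e : R, 0 < e & forall x y, unit_cball m x -> `|x - y| < e ->
    0 < overlap (F x) (F y).
Proof.
move=> cF.
pose P (e : R) x := forall y, `|x - y| < e -> 0 < overlap (F x) (F y).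
have eP : \forall e \near (0 : R)^'+, unit_cball m `<=` P e.
  apply: (compact_near_coveringP _).1; first exact: unit_cball_compact.
  move=> x _.
  have cO : continuous (fun p : 'rV[R]_m * 'rV[R]_m =>
      overlap (F p.1) (F p.2)).
    apply: overlap_continuous; apply: continuous_compT => //.
      by move=> p; exact: cvg_fst.
    by move=> p; exact: cvg_snd.
  have Oxx : 0 < overlap (F x) (F x).
    by rewrite -(to_proj_repr (F x)) overlapE dotxx expr1n ltr01.
  have [[U V] [/= Ux /nbhs_ballP[d /= d0 dV]] UV] := cO (x, x) _ (lt_nbhsr Oxx).
  (* Two halves of [d]: one for the distance from [x] to [x'], one for that from [x'] to [y]. *)
  exists ((U `&` ball x (d / 2)), [set e | e < d / 2]) => /=.
    split; last by apply: nbhs_right_lt; rewrite divr_gt0.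
    by apply: filterI => //; apply: nbhsx_ballx; rewrite divr_gt0.
  move=> [x' e] /= [[Ux' bx'] ed] y xy; apply: (UV (x', y)); split=> //=.
  apply: dV; rewrite (splitr d); apply: (ball_triangle bx').
  by rewrite -ball_normE /=; exact: lt_trans ed.
have [e [Pe e0]] : exists e : R, (unit_cball m `<=` P e) /\ 0 < e.
  by apply: (@filter_ex _ (0^'+)); apply: filterI eP _; exact: nbhs_right_gt.
by exists e => // x y x1; exact: Pe.
Qed.

Lemma lift_unit_cball (f : 'rV[R]_m -> proj_space R n) :
  {within unit_cball m, continuous f} ->
  exists2 s : 'rV[R]_m -> sphere R n, continuous s &
    forall x, unit_cball m x -> to_proj (s x) = f x.
Proof.
move=> /continuous_ball_retract; set F := fun x => _ => cF.
have [e e0 Fe] := overlap_uniform cF.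
(* [N] satisfies 1/(N+1) < e, so N+1 equal steps along a ray of the ball are all shorter than
   [e]. *)
have [N] := ltr_add_invr e0; rewrite add0r => Ne.
pose c k : R := k%:R / N.+1%:R.
pose pt k x : 'rV[R]_m := c k *: ball_retract x.
have c01 k : (k <= N.+1)%N -> 0 <= c k <= 1.
  by move=> kN; rewrite divr_ge0 //= ler_pdivrMr ?mul1r ?ler_nat ?ltr0n.
have ptc k : continuous (pt k).
  move=> x; exact: (cvgZl_tmp (@ball_retract_continuous R m x)).
have ptS k x : `|pt k x - pt k.+1 x| < e.
  rewrite -scalerBl normrZ; apply: le_lt_trans Ne.
  rewrite /c -mulrBl -opprB -natrB // subSnn mulN1r normrN.
  rewrite ger0_norm ?invr_ge0 // ler_piMr ?invr_ge0 //.
  exact: unit_cball_norm (ball_retract_in x).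
have lift k : (k <= N.+1)%N -> exists2 s : 'rV[R]_m -> sphere R n,
    continuous s & forall x, to_proj (s x) = F (pt k x).
  elim: k => [_|k IH kN].
    (* At stage 0 every point is at the center, and any constant lift serves. *)
    exists (fun=> repr (F 0)) => [|x]; first exact: cst_continuous.
    by rewrite to_proj_repr /pt /c mul0r scale0r.
  have [s cs sF] := IH (ltnW kN).
  apply: (lift_step cs (continuous_compT (ptc k.+1) cF)) => x.
  rewrite sF; apply: Fe => //.
  by apply: unit_cballZ (c01 _ (ltnW kN)) _; exact: ball_retract_in.
have [s cs sF] := lift _ (leqnn _); exists s => // x x1.
rewrite sF /pt /c divff ?pnatr_eq0 // scale1r /F.
by rewrite !ball_retract_id //; exact: ball_retract_in.
Qed.

Lemma regular_cell_compact (X : topologicalType) (e : set X) :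
  is_regular_cell R m e -> compact (closure e).
Proof.
move=> [f [g [cf _ _ <- _]]].
by apply: continuous_compact => //; exact: unit_cball_compact.
Qed.

Lemma regular_cell_connected (X : topologicalType) (e : set X) :
  is_regular_cell R m e -> connected (closure e).
Proof.
move=> [f [g [cf _ _ <- _]]].
apply: connected_continuous_connected => //; exact: unit_cball_connected.
Qed.

End Lift.

Lemma closure_image (X Y : topologicalType) (f : X -> Y) (A : set X) :
  continuous f -> f @` closure A `<=` closure (f @` A).
Proof.
move=> cf _ [x clx <-] U /cf /clx [z [Az Uz]].
by exists (f z); split=> //; exists z.
Qed.

Lemma regular_cell_no_antipodes (R : realType) (n m m' : nat)
    (e : set (sphere R n)) (x : sphere R n) :
  hausdorff_space (sphere R n) -> is_regular_cell R m e ->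
  is_regular_cell R m' ((@to_proj R n) @` e) ->
  closure e x -> ~ closure e (antipode x).
Proof.
move=> hS /regular_cell_connected ce [f [g [cf _ fK fcl _]]].
have [s cs sf] := lift_unit_cball cf.
pose A := s @` unit_cball m'.
have clA : closed A.
  apply: compact_closed => //; apply: continuous_compact.
    exact: continuous_subspaceT.
  exact: unit_cball_compact.
have clNA : closed (@antipode R n @^-1` A).
  by apply: closed_comp => // y _; exact: antipode_continuous.
(* Two antipodal points of the section lie over one line, hence over one point of the ball by
   injectivity of [f]; they would then coincide. *)
have disj y : A y -> ~ A (antipode y).
  move=> [u u1 <-] [v v1 svu].
  have : f v = f u by rewrite -!sf // svu to_proj_antipode.
  move=> /(congr1 g); rewrite !fK ?inE // => vu.
  by apply: (@antipode_neq _ _ (s u)); rewrite -svu vu.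
have sepA : separated A (@antipode R n @^-1` A).
  rewrite /separated -(closure_id _).1 // -(closure_id _).1 //.
  by rewrite (_ : _ `&` _ = set0) // -subset0 => y [/disj].
have cov : closure e `<=` A `|` @antipode R n @^-1` A.
  move=> y cy; have : closure ((@to_proj R n) @` e) (to_proj y).
    by apply: (closure_image (@to_proj_continuous R n)); exists y.
  rewrite -fcl => -[z z1]; rewrite -sf // => /to_projE [->|szy].
    by left; exists z.
  by right; exists z => //; rewrite szy antipodeK.
move=> cx cNx.
(* Connectedness confines the closed cell to one sheet, which would then contain both antipodal
   points. *)
have [eA|eA] := connected_subset sepA cov ce.
  exact: disj (eA _ cx) (eA _ cNx).
by apply: disj (eA _ cNx) _; rewrite antipodeK; exact: eA _ cx.
Qed.

(** * Faces of an antipodal quotient *)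

Section Subdivision.
Variables (R : realType) (X : topologicalType) (K : regular_subdivision R X).
Implicit Types e : K.

Lemma cell_inhabited e : val e !=set0.
Proof.
have [_ _ _ /(_ _ (valP e))[m [f [g [_ _ _ _ <-]]]] _] := cellsP K.
by exists (f 0); exists 0 => //; rewrite /unit_oball/= /sqnorm big1 // => i _;
  rewrite mxE expr0n.
Qed.

Lemma cell_eq e e' x : val e x -> val e' x -> e = e'.
Proof.
move=> ex ex'; have [_ _ disj _ _] := cellsP K.
by apply/val_inj/disj; [exact: valP|exact: valP|exists x].
Qed.

Lemma cell_closure_compact e : compact (closure (val e)).
Proof.
have [_ _ _ /(_ _ (valP e))[m em] _] := cellsP K.
exact: regular_cell_compact em.
Qed.

(** The boundary of [e'] is a union of cells, and cells that meet are equal. *)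
Lemma cell_sub_closure e e' x :
  val e x -> closure (val e') x -> val e `<=` closure (val e').
Proof.
move=> ex cx; have [_ _ disj _ /(_ _ (valP e'))[D DK clD]] := cellsP K.
have [ex'|nex'] := pselect (val e' x).
  by rewrite (cell_eq ex ex'); exact: subset_closure.
have : (closure (val e') `\` val e') x by [].
rewrite clD => -[e1 De1 e1x].
have -> : val e = e1 by apply: disj; [exact: valP|exact: DK|exists x].
have : e1 `<=` \bigcup_(e2 in D) e2 by move=> y e1y; exists e1.
by rewrite -clD => h y /h[].
Qed.

End Subdivision.

(** * The projection of face posets as a two-sheeted covering *)

Section AntipodalQuotient.
Variables (R : realType) (n : nat).
Variable Omega : regular_subdivision R (sphere R n).
Hypothesis Omega_symmetric : centrally_symmetric (cells Omega).
Hypothesis Omega'_regular :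
  is_regular_subdivision R (antipodal_image (cells Omega)).
Let Omega' : regular_subdivision R (proj_space R n) :=
  RegularSubdivision Omega'_regular.
Implicit Types e : Omega.

Lemma proj_cell_subproof e : (@to_proj R n) @` val e \in cells Omega'.
Proof. by apply/imfsetP; exists (val e) => //; exact: valP. Qed.

Definition proj_cell e : Omega' := [` proj_cell_subproof e]%fset.

Definition opp_cell e : Omega := [` Omega_symmetric (valP e)]%fset.

Definition proj_face (x : face Omega) : face Omega' :=
  match x with Bot => Bot _ | Cell e => Cell (proj_cell e) | Top => Top _ end.

Lemma opp_cellP e x : val (opp_cell e) x <-> val e (antipode x).
Proof.
split=> [[y ey <-]|ex]; first by rewrite antipodeK.
by exists (antipode x); rewrite ?antipodeK.
Qed.

Lemma proj_cell_opp e : proj_cell (opp_cell e) = proj_cell e.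
Proof.
apply: val_inj; apply/seteqP; split=> [_ [x /opp_cellP ex <-]|_ [x ex <-]].
  by exists (antipode x); rewrite ?to_proj_antipode.
by exists (antipode x); rewrite ?to_proj_antipode //; apply/opp_cellP;
  rewrite antipodeK.
Qed.

Lemma proj_cell_surj (e' : Omega') : exists e, e' = proj_cell e.
Proof.
have /imfsetP[/= e eO e'E] := valP e'.
by exists [` eO]%fset; exact: val_inj.
Qed.

Lemma cell_no_antipodes e x :
  closure (val e) x -> ~ closure (val e) (antipode x).
Proof.
have [hS _ _ /(_ _ (valP e))[m em] _] := cellsP Omega.
have [_ _ _ /(_ _ (proj_cell_subproof e))[m' em'] _] := cellsP Omega'.
exact: regular_cell_no_antipodes hS em em'.
Qed.

Lemma opp_cell_neq e : opp_cell e <> e.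
Proof.
move=> eNe; have [x ex] := cell_inhabited e.
apply: (@cell_no_antipodes e x); first exact: subset_closure.
by apply: subset_closure; apply/opp_cellP; rewrite eNe.
Qed.

(** The image of a closed cell is compact, hence closed in the Hausdorff projective space. *)
Lemma closure_proj_cell e :
  closure (val (proj_cell e)) = (@to_proj R n) @` closure (val e).
Proof.
apply/seteqP; split; last exact: closure_image (@to_proj_continuous R n).
have [hP _ _ _ _] := cellsP Omega'.
have cl : closed ((@to_proj R n) @` closure (val e)).
  apply: compact_closed => //; apply: continuous_compact.
    by apply: continuous_subspaceT; exact: to_proj_continuous.
  exact: cell_closure_compact.
rewrite [X in _ `<=` X](closure_id _).1 //; apply: closureS.
by apply: image_subset; exact: subset_closure.
Qed.

(** Over the line through a point of [e] lies a point of the closure of [e']: either that point or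
    its antipode. The whole cell containing it follows. *)
Lemma proj_cell_le e e' : val (proj_cell e) `<=` closure (val (proj_cell e')) ->
  val e `<=` closure (val e') \/ val (opp_cell e) `<=` closure (val e').
Proof.
rewrite closure_proj_cell => ee'; have [x ex] := cell_inhabited e.
have [|y cy /esym/to_projE[yx|yx]] := ee' (to_proj x); first by exists x.
  by left; apply: cell_sub_closure ex _; rewrite -yx.
right; apply: (@cell_sub_closure _ _ _ _ _ y) cy.
by apply/opp_cellP; rewrite yx antipodeK.
Qed.

Lemma proj_face_homo : {homo proj_face : x y / (x <= y)%O}.
Proof.
case=> [|e|] [|e'|] //= /asboolP ee'; apply/asboolP.
rewrite closure_proj_cell; exact: image_subset.
Qed.

(** Otherwise the opposite of [x] would lie below [y], and the closure of [p] would contain a point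
    of [x] together with its antipode. *)
Lemma proj_face_embed p x y : p != \top%O -> (x <= p)%O -> (y <= p)%O ->
  (proj_face x <= proj_face y)%O -> (x <= y)%O.
Proof.
case: p x y => [|p|] [|x|] [|y|] //= _ /asboolP xp /asboolP yp /asboolP.
case/proj_cell_le => [xy|xy]; first exact/asboolP.
have [z zx] := cell_inhabited x; exfalso.
apply: (@cell_no_antipodes p z); first exact: xp.
have /xy cz : val (opp_cell x) (antipode z).
  by apply/opp_cellP; rewrite antipodeK.
have := closureS yp cz.
by rewrite -(closure_id (closure _)).1 //; exact: closed_closure.
Qed.

(** A cell [q] is the image of some [e], and either [e] or its opposite lies below [p]. *)
Lemma proj_face_lift p q : p != \top%O -> (q <= proj_face p)%O ->
  exists2 x, (x <= p)%O & proj_face x = q.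
Proof.
case: p => [|p|] // _; case: q => [|q|] //.
- by exists (Bot _).
- by exists (Bot _).
have [e ->] := proj_cell_surj q.
move=> /asboolP/proj_cell_le[ep|ep].
  by exists (Cell e) => //; exact/asboolP.
exists (Cell (opp_cell e)); first exact/asboolP.
by rewrite /= proj_cell_opp.
Qed.

Lemma proj_face_fiber q : (\bot < q < \top)%O ->
  exists x y, x <> y /\ forall z, proj_face z = q <-> z = x \/ z = y.
Proof.
case: q => [|q|]; rewrite ?ltxx ?andbF // => _.
have [e ->] := proj_cell_surj q.
exists (Cell e), (Cell (opp_cell e)); split.
  by move=> [/esym/opp_cell_neq].
case=> [|e1|]; split; try by [|case].
  move=> [/= e1e]; have [x e1x] := cell_inhabited e1.
  have : ((@to_proj R n) @` val e1) (to_proj x) by exists x.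
  (* A cell with the same image as [e] contains a point of [e] or the antipode of one, which
     identifies it. *)
  rewrite e1e => -[y ey /esym/to_projE[yx|yx]].
    by left; congr Cell; apply: cell_eq e1x _; rewrite -yx.
  right; congr Cell; apply: cell_eq e1x _; apply/opp_cellP; rewrite -yx //.
by move=> [] [->]; rewrite /= ?proj_cell_opp.
Qed.

Lemma flag_f_antipodal r (S : {set 'I_r}) : S != finset.set0 ->
  @flag_f _ (face Omega) r S = (2 * @flag_f _ (face Omega') r S)%N.
Proof.
apply: (flag_f_cover (f := proj_face)).
- exact: proj_face_homo.
- by case.
- by case.
- exact: proj_face_embed.
- exact: proj_face_lift.
- exact: proj_face_fiber.
Qed.

End AntipodalQuotient.

Theorem theorem1p46 (R : realType) (n : nat)
    (Omega : regular_subdivision R (sphere R n))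
    (Omega_symmetric : centrally_symmetric (cells Omega))
    (Omega'_regular :
       is_regular_subdivision R (antipodal_image (cells Omega)))
    (Phi : ab_poly)
    (Psi_Omega : Psi Omega n = var_c ^+ n.+1 + Phi) :
  Psi (RegularSubdivision Omega'_regular) n =
    2^-1 *: (var_c ^+ n.+1 + (var_a - var_b) ^+ n.+1) + 2^-1 *: Phi.
Proof.
(* The right-hand side is regrouped as half the sum of [Psi Omega n] and (a - b)^(n+1). *)
rewrite -scalerDr addrAC -Psi_Omega; apply: ab_index_halve => T.
exact: flag_f_antipodal Omega_symmetric Omega'_regular n.+1 T.
Qed.
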